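(* Let $u\in\mathbb{Z}^n$ have positive entries, let $\mathcal H=\{x\in\mathbb{Z}^n_+: x_i\le u_i\ \forall i\}$, and let $\gamma,\theta\in\mathcal H$. Then $$\operatorname{conv}\{x\in\mathcal H:\gamma\preccurlyeq x\preccurlyeq\theta\}=\operatorname{conv}\{x\in\mathcal H: x\succcurlyeq\gamma\}\cap\operatorname{conv}\{x\in\mathcal H: x\preccurlyeq\theta\}.$$ In particular, if $K^{\le}=\{x\in\mathcal H: a^\top x\le b\}$ and $K^{\ge}=\{x\in\mathcal H: w^\top x\ge d\}$ are two superincreasing knapsacks, where $a,w\in\mathbb{Z}^n$ have strictly positive entries and $b,d$ are positive integers, then $$\operatorname{conv}(K^{\le}\cap K^{\ge})=\operatorname{conv}K^{\le}\cap\operatorname{conv}K^{\ge}.$$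
   Context: Lexicographic order (read from the last coordinate): for $v^1,v^2\in\mathbb{Z}^n$, $v^1\preccurlyeq v^2$ (equivalently $v^2\succcurlyeq v^1$) if $v^1=v^2$ or, with $i$ the largest index such that $v^1_i\ne v^2_i$, one has $v^1_i<v^2_i$. The knapsack $K^{\le}$ is superincreasing if $\sum_{k=1}^i a_ku_k\le a_{i+1}$ for all $1\le i\le n-1$; $K^{\ge}$ is superincreasing if $\sum_{k=1}^i w_ku_k\le w_{i+1}$ for all $1\le i\le n-1$. $\operatorname{conv}$ denotes convex hull in $\mathbb{R}^n$. *)

(* Defs.v *)
From mathcomp Require Import all_boot all_order all_algebra.
From mathcomp Require Import all_classical all_reals convex.

Set Implicit Arguments.
Unset Strict Implicit.
Unset Printing Implicit Defensive.

Import Order.TTheory GRing.Theory Num.Theory.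

Local Open Scope classical_set_scope.
Local Open Scope ring_scope.

Definition convex_hull (R : realType) (n : nat) (A : set 'rV[R]_n) :
    set 'rV[R]_n :=
  smallest (@convex_set R 'rV[R]_n) A.

Definition convZ (R : realType) (n : nat) (S : set 'rV[int]_n) :
    set 'rV[R]_n :=
  convex_hull [set map_mx (intr : int -> R) x | x in S].
Arguments convZ R [n] S.

Definition box (n : nat) (u : 'rV[int]_n) : set 'rV[int]_n :=
  [set x | forall i, 0 <= x 0 i /\ x 0 i <= u 0 i].

(* The witness [i] is the largest index at which [x] and [y] differ: the
   comparison reads coordinates from the last one, unlike [tuplelexi]. *)
Definition lexle (n : nat) (x y : 'rV[int]_n) : Prop :=
  x = y \/
  exists i : 'I_n,
    [/\ x 0 i <> y 0 i, forall j : 'I_n, (i < j)%N -> x 0 j = y 0 j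
      & x 0 i < y 0 i].

Definition dotZ (n : nat) (a x : 'rV[int]_n) : int :=
  \sum_(i < n) a 0 i * x 0 i.

Definition knapsack_le (n : nat) (u a : 'rV[int]_n) (b : int) :
    set 'rV[int]_n :=
  [set x | box u x /\ dotZ a x <= b].

Definition knapsack_ge (n : nat) (u w : 'rV[int]_n) (d : int) :
    set 'rV[int]_n :=
  [set x | box u x /\ d <= dotZ w x].

Definition superincreasing (n : nat) (u a : 'rV[int]_n) : Prop :=
  forall i j : 'I_n, (j : nat) = i.+1 ->
    \sum_(k < n | (k <= i)%N) a 0 k * u 0 k <= a 0 j.

(* Main.v *)
(* Let i be the last index at which gamma and theta differ, and let x lie in
   both hulls.  Passing repeatedly to faces, x is in the hull of the
   lexicographic lower set of theta and in that of the upper set of gamma, both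
   restricted to points agreeing with theta beyond i.  If gamma_i > theta_i this is
   impossible.  Otherwise x splits as p + q + r, where
   - p, of weight lam = max(0, x_i - theta_i + 1), is carried by points <= theta
     with i-th coordinate theta_i, and p_k = max(0, x_k - (1 - lam) u_k) for
     k < i;
   - q, of weight mu = max(0, gamma_i - x_i + 1), is carried by points >= gamma
     with i-th coordinate gamma_i and q_k = min(x_k, mu u_k) for k < i;
   - r is carried by the box with gamma_i + 1 <= s_i <= theta_i - 1.
   The point p exists because the slice s_i = theta_i is stable under decreasing
   the coordinates below i, hence so is its hull; q is obtained by the
   reflection x -> u - x.  All points involved lie between gamma and theta.
   A superincreasing weight is monotone for the lexicographic order, so each
   knapsack is a lexicographic lower or upper set of the box. *)
Require Import Defs.
From mathcomp Require Import all_boot all_order all_algebra.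
From mathcomp Require Import all_classical all_reals convex.
From mathcomp Require Import interval_inference.
From mathcomp Require Import ring lra zify.

Set Implicit Arguments.
Unset Strict Implicit.
Unset Printing Implicit Defensive.

Import Order.TTheory GRing.Theory Num.Theory.

Local Open Scope classical_set_scope.
Local Open Scope ring_scope.

(** * Weighted combinations and convex hulls *)

(* [comb A m x]: x is a nonnegative combination of points of A with total
   weight m, so that conv A is [comb A 1]; keeping the weight as an index
   avoids normalizations. *)
Inductive comb (R : realType) (n : nat) (A : set 'rV[int]_n) :
    R -> 'rV[R]_n -> Prop :=
| comb_nil : comb A 0 0
| comb_cons w s m x : 0 <= w -> A s -> comb A m x ->
    comb A (w + m) (w *: map_mx intr s + x).

Lemma comb_ge0 (R : realType) n (A : set 'rV[int]_n) (m : R) x :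
  comb A m x -> 0 <= m.
Proof. by elim=> // w s {}m {}x w0 _ _ m0; apply: addr_ge0. Qed.

Lemma comb_single (R : realType) n (A : set 'rV[int]_n) (w : R) s :
  0 <= w -> A s -> comb A w (w *: map_mx intr s).
Proof.
move=> w0 As; rewrite -[w in comb _ w]addr0 -[X in comb _ _ X]addr0.
by apply: comb_cons => //; apply: comb_nil.
Qed.

Lemma combD (R : realType) n (A : set 'rV[int]_n) (m m' : R) x x' :
  comb A m x -> comb A m' x' -> comb A (m + m') (x + x').
Proof.
move=> + Ax'; elim=> [|w s {}m {}x w0 As _ IH]; first by rewrite !add0r.
by rewrite -!addrA; apply: comb_cons.
Qed.

Lemma combZ (R : realType) n (A : set 'rV[int]_n) (k m : R) x :
  0 <= k -> comb A m x -> comb A (k * m) (k *: x).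
Proof.
move=> k0; elim=> [|w s {}m {}x w0 As _ IH].
  by rewrite mulr0 scaler0; apply: comb_nil.
by rewrite mulrDr scalerDr scalerA; apply: comb_cons => //; apply: mulr_ge0.
Qed.

Lemma sub_comb (R : realType) n (A B : set 'rV[int]_n) (m : R) x :
  A `<=` B -> comb A m x -> comb B m x.
Proof.
move=> AB; elim=> [|w s {}m {}x w0 As _ IH]; first exact: comb_nil.
by apply: comb_cons => //; apply: AB.
Qed.

Lemma combU (R : realType) n (A B : set 'rV[int]_n) (m : R) x :
  comb (A `|` B) m x -> exists mA xA mB xB,
    [/\ comb A mA xA, comb B mB xB, m = mA + mB & x = xA + xB].
Proof.
elim=> [|w s {}m {}x w0 ABs _ [mA [xA [mB [xB [Ax Bx -> ->]]]]]].
  by exists 0, 0, 0, 0; rewrite !addr0; split=> //; apply: comb_nil.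
case: ABs => [As|Bs].
  exists (w + mA), (w *: map_mx intr s + xA), mB, xB.
  by rewrite !addrA; split=> //; apply: comb_cons.
exists mA, xA, (w + mB), (w *: map_mx intr s + xB).
by split=> //; first apply: comb_cons => //; rewrite addrCA.
Qed.

Lemma comb_neq0 (R : realType) n (A : set 'rV[int]_n) (m : R) x :
  comb A m x -> m != 0 -> exists s, A s.
Proof. by case=> [|w s ? ? _ As _ _]; [rewrite eqxx|exists s]. Qed.

Lemma comb_eq0 (R : realType) n (A : set 'rV[int]_n) (x : 'rV[R]_n) :
  comb A 0 x -> x = 0.
Proof.
move mE: 0 => m Ax; elim: Ax mE => // w s m' y w0 _ Ay IH /esym/eqP.
rewrite paddr_eq0 ?(comb_ge0 Ay)// => /andP[/eqP -> /eqP m0].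
by rewrite IH// scale0r addr0.
Qed.

(** Combinations of weight 1 form a convex set containing [A]. Conversely, a convex set containing
    [A] contains every combination of positive weight divided by that weight, by induction on the
    terms. *)
Lemma convZE (R : realType) n (A : set 'rV[int]_n) x :
  convZ R A x <-> comb A 1 x.
Proof.
split=> [Ax|Ax].
  apply: (Ax [set y | comb A 1 y]); split => /=.
    move=> y z t; rewrite !inE /= => Ay Az.
    have -> : 1 = t%:num * 1 + (1 - t%:num) * 1 :> R by ring.
    by apply: combD; apply: combZ => //; rewrite subr_ge0 le1.
  by move=> _ [s As <-] /=; rewrite -[map_mx _ s]scale1r; apply: comb_single.
move=> C [Ccvx AC].
suff main m y : comb A m y -> 0 < m -> C (m^-1 *: y).
  by have := main _ _ Ax ltr01; rewrite invr1 scale1r.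
elim=> [|w s {}m {}y w0 As Ay IH wm0]; first by rewrite ltxx.
have m0 := comb_ge0 Ay.
have Cs : C (map_mx intr s) by apply: AC; exists s.
have [m_eq0|m_gt0] := eqVneq m 0.
  have -> : y = 0 by move: Ay; rewrite m_eq0; apply: comb_eq0.
  move: wm0; rewrite m_eq0 !addr0 => wm0.
  by rewrite scalerA mulVf ?gt_eqF// scale1r.
have {}m_gt0 : 0 < m by rewrite lt_neqAle eq_sym m_gt0.
(* The normalized sum is the convex combination of [s] and the normalized tail in which [s] has
   weight [w / (w + m)]. *)
have t01 : Itv.spec (@Itv.num_sem R) (Itv.Real `[0%Z, 1%Z]) (w / (w + m)).
  rewrite /Itv.spec /Itv.num_sem /= realE divr_ge0 ?(ltW wm0)//= in_itv /=.
  by rewrite divr_ge0 ?(ltW wm0)//= ler_pdivrMr// mul1r lerDl.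
pose t : {i01 R} := Itv.mk t01.
have /(_ t) :=
  Ccvx (map_mx intr s) (m^-1 *: y) _ (mem_set Cs) (mem_set (IH m_gt0)).
move/set_mem; congr C.
rewrite /conv /= scalerDr !scalerA; congr (_ *: _ + _ *: _).
  by rewrite mulrC.
rewrite [LHS](_ : _ = (1 - w / (w + m)) / m)//; field.
by rewrite !gt_eqF.
Qed.

(** * Faces, reflections and coordinate changes of combinations *)

Section Coordinates.
Variables (R : realType) (n : nat).
Implicit Types (A : set 'rV[int]_n) (m : R) (x y : 'rV[R]_n).

Lemma comb_face_le A (c : int) (i : 'I_n) m x :
  (forall s, A s -> s 0 i <= c) -> comb A m x ->
  x 0 i <= m * c%:~R /\
  (x 0 i = m * c%:~R -> comb (A `&` [set s | s 0 i = c]) m x).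
Proof.
move=> Ac; elim=> [|w s {}m {}x w0 As Ax [IHle IHeq]].
  by rewrite mxE mul0r; split=> // _; apply: comb_nil.
have sc : (s 0 i)%:~R <= c%:~R :> R by rewrite ler_int Ac.
have wsc : w * (s 0 i)%:~R <= w * c%:~R by rewrite ler_wpM2l.
rewrite !mxE mulrDl; split; first exact: lerD.
move=> E; have Ex : x 0 i = m * c%:~R by lra.
have Ew : w * (c%:~R - (s 0 i)%:~R) = 0 by lra.
move/eqP: Ew; rewrite mulf_eq0 => /orP[/eqP ->|/eqP Es].
  by rewrite scale0r !add0r; apply: IHeq.
apply: comb_cons => //; last exact: IHeq.
by split=> //=; apply/eqP; rewrite -(eqr_int R); apply/eqP; lra.
Qed.

Lemma comb_reflect A (u : 'rV[int]_n) m x :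
  comb A m x -> comb [set s | A (u - s)] m (m *: map_mx intr u - x).
Proof.
elim=> [|w s {}m {}x w0 As _ IH].
  by rewrite scale0r subr0; apply: comb_nil.
have -> : (w + m) *: map_mx intr u - (w *: map_mx intr s + x) =
    w *: map_mx intr (u - s) + (m *: map_mx intr u - x) :> 'rV[R]_n.
  by rewrite map_mxB scalerBr scalerDl opprD addrACA.
by apply: comb_cons => //=; rewrite subKr.
Qed.

Lemma comb_face_ge A (c : int) (i : 'I_n) m x :
  (forall s, A s -> c <= s 0 i) -> comb A m x ->
  m * c%:~R <= x 0 i /\
  (x 0 i = m * c%:~R -> comb (A `&` [set s | s 0 i = c]) m x).
Proof.
(* Reflection with [u = 0] is negation, which exchanges the two kinds of bounds. *)
move=> Ac /(comb_reflect 0) Ax.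
have [s /Ac|le face] := comb_face_le (c := - c) (i := i) _ Ax.
  by rewrite !mxE sub0r => cs; rewrite lerNr.
move: le face; rewrite !mxE mulr0 sub0r intrN mulrN lerN2 => le face.
split=> // Ex; have := comb_reflect 0 (face (congr1 -%R Ex)).
rewrite subKr; apply: sub_comb => s /=; rewrite subKr !mxE sub0r => -[As].
by move=> /oppr_inj sc; split.
Qed.

Lemma comb_coord_eq A (c : int) (i : 'I_n) m x :
  (forall s, A s -> s 0 i = c) -> comb A m x -> x 0 i = m * c%:~R.
Proof.
move=> Ac Ax; apply/eqP; rewrite eq_le.
by rewrite (proj1 (comb_face_le _ Ax)) ?(proj1 (comb_face_ge _ Ax))//
  => s /Ac ->; exact: lexx.
Qed.

Definition set_coord (T : Type) (v : 'rV[T]_n) (k : 'I_n) (s : 'rV[T]_n) :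
  'rV[T]_n := \row_j (if j == k then v 0 j else s 0 j).

Lemma comb_set_coord A (v : 'rV[int]_n) (k : 'I_n) m x :
  (forall s, A s -> A (set_coord v k s)) -> comb A m x ->
  comb A m (set_coord (m *: map_mx intr v) k x).
Proof.
move=> Av; elim=> [|w s {}m {}x w0 As _ IH].
  have -> : set_coord (0 *: map_mx intr v) k 0 = 0 :> 'rV[R]_n.
    by apply/rowP => j; rewrite !mxE mul0r; case: ifP.
  exact: comb_nil.
have -> : set_coord ((w + m) *: map_mx intr v) k (w *: map_mx intr s + x) =
    w *: map_mx intr (set_coord v k s) + set_coord (m *: map_mx intr v) k x.
  by apply/rowP => j; rewrite !mxE; case: ifP => // _; rewrite mulrDl.
by apply: comb_cons => //; apply: Av.
Qed.

Lemma comb_convex A m x y (t : R) :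
  0 <= t <= 1 -> comb A m x -> comb A m y ->
  comb A m ((1 - t) *: x + t *: y).
Proof.
move=> /andP[t0 t1] Ax Ay; have -> : m = (1 - t) * m + t * m by ring.
by apply: combD; apply: combZ => //; rewrite subr_ge0.
Qed.

(** Coordinates are moved one at a time. If [A] is stable under resetting coordinate [k] to [v 0 k],
    the hull contains the segment from the current point to its reset image, and [y 0 k] is reached
    on that segment. *)
Lemma comb_between A (v : 'rV[int]_n) (P : pred 'I_n) m x y :
  (forall k s, P k -> A s -> A (set_coord v k s)) -> comb A m x ->
  (forall k, ~~ P k -> y 0 k = x 0 k) ->
  (forall k, P k -> x 0 k <= y 0 k <= m * (v 0 k)%:~R \/
                    m * (v 0 k)%:~R <= y 0 k <= x 0 k) ->
  comb A m y.
Proof.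
move=> Av Ax yNP yP.
(* [z j] already has the first [j] coordinates of [y]; the others are still those of [x]. *)
pose z j := \row_k (if (k < j)%N then y 0 k else x 0 k).
suff zj j : (j <= n)%N -> comb A m (z j).
  suff -> : y = z n by apply: zj.
  by apply/rowP => k; rewrite mxE ltn_ord.
elim: j => [_|j IH jn].
  by suff -> : z 0%N = x by []; apply/rowP => k; rewrite mxE ltn0.
pose k := Ordinal jn.
have {IH} Az : comb A m (z j) by apply: IH; apply: ltnW.
have [Pk|NPk] := boolP (P k); last first.
  suff -> : z j.+1 = z j by [].
  apply/rowP => l; rewrite !mxE ltnS leq_eqVlt.
  have [lj|//] := eqVneq (l : nat) j.
  by have -> : l = k by [apply/val_inj]; rewrite ltnn yNP.
have Azk := comb_set_coord (fun s => Av k s Pk) Az.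
suff [t t01 tE] : exists2 t, 0 <= t <= 1 &
    y 0 k = (1 - t) * x 0 k + t * (m * (v 0 k)%:~R).
  suff -> : z j.+1 =
      (1 - t) *: z j + t *: set_coord (m *: map_mx intr v) k (z j).
    exact: comb_convex.
  apply/rowP => l; rewrite !mxE ltnS leq_eqVlt.
  have [->|lk] := eqVneq l k; first by rewrite eqxx ltnn /= tE.
  rewrite (_ : (l == j :> nat) = false) /=; first by case: ifP => _; ring.
  by apply/negbTE; apply: contraNneq lk => lj; apply/eqP/val_inj.
(* Solving for [t] gives [(b - a) / (c - a)]; when [a = c] the segment is a point and [t = 0]
   serves. *)
have := yP k Pk; set a := x 0 k; set b := y 0 k; set c := m * _ => bP.
have [ac|ac] := eqVneq a c.
  exists 0; first by rewrite lexx ler01.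
  by rewrite subr0 mul0r addr0 mul1r; move: ac bP; lra.
have ca0 : c - a != 0 by rewrite subr_eq0 eq_sym.
exists ((b - a) / (c - a)); last by field.
have [ca|ca] := ltP 0 (c - a).
  by rewrite divr_ge0 ?ler_pdivrMr//=; lra.
have {}ca : 0 < a - c by rewrite lt_neqAle eq_sym subr_eq0 ac; lra.
have -> : (b - a) / (c - a) = (a - b) / (a - c) by field; rewrite ca0 gt_eqF.
by rewrite divr_ge0 ?ler_pdivrMr//=; lra.
Qed.

End Coordinates.
(** The scaled upper corner [m *: h] is a one-term combination, and a box is stable under resetting
    any coordinate to that of [l], so every coordinate can be lowered independently. *)
Lemma comb_box (R : realType) n (l h : 'rV[int]_n) (m : R) (x : 'rV[R]_n) :
  0 <= m ->
  (forall k, m * (l 0 k)%:~R <= x 0 k /\ x 0 k <= m * (h 0 k)%:~R) ->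
  comb [set s | forall k, l 0 k <= s 0 k /\ s 0 k <= h 0 k] m x.
Proof.
(* At weight 0 the box may be empty, since the bounds on [x] then say nothing about [l] and [h]. *)
move=> m0 xlh; have [m_eq0|m_neq0] := eqVneq m 0.
  have -> : x = 0.
    apply/rowP => k; rewrite mxE; apply/eqP; rewrite eq_le.
    by have := xlh k; rewrite m_eq0 !mul0r => -[-> ->].
  by rewrite m_eq0; apply: comb_nil.
have m_gt0 : 0 < m by rewrite lt_neqAle eq_sym m_neq0.
have lh k : l 0 k <= h 0 k.
  have [lx xh] := xlh k.
  by rewrite -(ler_int R) -(ler_pM2l m_gt0); apply: le_trans lx xh.
apply: (@comb_between _ _ _ l predT m (m *: map_mx intr h)) => //.
- move=> k s _ slh j; rewrite mxE; case: ifP => [_|_]; last exact: slh.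
  by split; [exact: lexx|exact: lh].
- by apply: comb_single => // k; rewrite lh lexx.
- by move=> k _; right; rewrite !mxE; apply/andP.
Qed.

(** * The lexicographic order *)

Section Lexicographic.
Variable n : nat.
Implicit Types x y z u v : 'rV[int]_n.

Lemma lexle_trans x y z : lexle x y -> lexle y z -> lexle x z.
Proof.
move=> [->//|[i [xyi xyj ltxy]]] [<-|[k [yzk yzj ltyz]]].
  by right; exists i.
right; have [ik|ki|/val_inj ik] := ltngtP i k.
- have Exy := xyj k ik.
  exists k; rewrite Exy; split=> // j kj.
  by rewrite xyj ?yzj//; apply: ltn_trans kj.
- have Eyz := yzj i ki.
  exists i; rewrite -Eyz; split=> // j ij.
  by rewrite xyj ?yzj//; apply: ltn_trans ij.
- rewrite -ik in ltyz yzj; have ltxz := lt_trans ltxy ltyz.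
  exists i; split=> //; first by move=> E; rewrite E ltxx in ltxz.
  by move=> j ij; rewrite xyj ?yzj.
Qed.

Lemma lexle_total x y : lexle x y \/ lexle y x.
Proof.
have [xy|] := pselect (forall i, x 0 i = y 0 i).
  by left; left; apply/rowP.
move=> /existsNP [i0 /eqP xyi0].
case: (@arg_maxnP _ i0 (fun i => x 0 i != y 0 i) (fun i => i : nat) xyi0).
move=> i xyi imax.
have xyj (j : 'I_n) : (i < j)%N -> x 0 j = y 0 j.
  by move=> ij; apply/eqP; apply: contraTT ij => /imax; rewrite -leqNgt.
have [ltxy|ltyx|E] := ltgtP (x 0 i) (y 0 i).
- by left; right; exists i; split=> //; apply/eqP.
- right; right; exists i; split=> //; first by apply/eqP; rewrite eq_sym.
  by move=> j /xyj.
- by rewrite E eqxx in xyi.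
Qed.

Lemma lexle_reflect u x y : lexle x y -> lexle (u - y) (u - x).
Proof.
move=> [->|[i [xyi xyj ltxy]]]; first by left.
have lt : (u - y) 0 i < (u - x) 0 i by rewrite !mxE ltrD2l ltrN2.
right; exists i; split=> //; first by move=> E; rewrite E ltxx in lt.
by move=> j ij; rewrite !mxE xyj.
Qed.

Lemma lexle_coord x y (i : 'I_n) :
  lexle x y -> (forall j : 'I_n, (i < j)%N -> x 0 j = y 0 j) ->
  x 0 i <= y 0 i.
Proof.
move=> [->//|[k [xyk xyj ltxy]]] xyi.
have [ik|ki|/val_inj ->] := ltngtP i k; last exact: ltW.
  by case: xyk; apply: xyi.
by rewrite xyj.
Qed.

Lemma lexle_set_coord v x (k : 'I_n) :
  v 0 k <= x 0 k -> lexle (set_coord v k x) x.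
Proof.
rewrite le_eqVlt => /orP[/eqP E|lt].
  by left; apply/rowP => j; rewrite mxE; case: eqP => // ->.
right; exists k; rewrite mxE eqxx; split=> //.
  by move=> E; rewrite E ltxx in lt.
by move=> j kj; rewrite mxE (_ : j == k = false)//; apply: gtn_eqF.
Qed.

Lemma box_reflect u x : box u x -> box u (u - x).
Proof.
by move=> xu i; have [x0 xu1] := xu i; rewrite !mxE subr_ge0 gerBl.
Qed.

End Lexicographic.

(** * Splitting off the extreme layer of a lexicographic slice *)

Section Slices.
Variables (R : realType) (n : nat) (u : 'rV[int]_n).
Implicit Types (x : 'rV[R]_n) (gamma theta : 'rV[int]_n).

(** Indices start at 0: [m = i.+1] leaves coordinate [i] free, while [m = i] freezes it too. *)
Definition slice_le theta (m : nat) : set 'rV[int]_n :=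
  [set s | [/\ box u s, lexle s theta &
               forall j : 'I_n, (m <= j)%N -> s 0 j = theta 0 j]].

Definition slice_ge gamma (m : nat) : set 'rV[int]_n :=
  [set s | [/\ box u s, lexle gamma s &
               forall j : 'I_n, (m <= j)%N -> s 0 j = gamma 0 j]].

Lemma slice_reflect gamma m s :
  slice_le (u - gamma) m (u - s) <-> slice_ge gamma m s.
Proof.
split=> -[su le eqm]; split.
- by rewrite -[s](subKr u); apply: box_reflect.
- by rewrite -[s](subKr u) -[gamma](subKr u); apply: lexle_reflect.
- by move=> j /eqm; rewrite !mxE => /addrI/oppr_inj.
- exact: box_reflect.
- exact: lexle_reflect.
- by move=> j /eqm; rewrite !mxE => ->.
Qed.

Lemma comb_box_bounds (A : set 'rV[int]_n) (m : R) x (i : 'I_n) :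
  A `<=` box u -> comb A m x -> 0 <= x 0 i <= m * (u 0 i)%:~R.
Proof.
move=> Au Ax; apply/andP; split.
  rewrite -[0](mulr0 m); apply: (proj1 (comb_face_ge (c := 0) _ Ax)) => s /Au.
  by move=> /(_ i)[].
by apply: (proj1 (comb_face_le _ Ax)) => s /Au /(_ i)[].
Qed.

(** Separating the points with [s 0 i = theta 0 i] from the others writes [x = a + b]. Scaling [a]
    down to weight [lam] and then lowering its coordinates below [i] gives the required point. *)
Lemma comb_slice_le theta (i : 'I_n) x
    (lam := Num.max 0 (x 0 i - (theta 0 i)%:~R + 1)) :
  comb (slice_le theta i.+1) 1 x ->
  comb (slice_le theta i) lam
    (\row_(k < n) if (k < i)%N then Num.max 0 (x 0 k - (1 - lam) * (u 0 k)%:~R)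
                  else lam * (theta 0 k)%:~R).
Proof.
move=> Dx.
have : comb (slice_le theta i `|`
             [set s | box u s /\ s 0 i <= theta 0 i - 1]) 1 x.
  apply: sub_comb Dx => s [su le eqi].
  have := lexle_coord le eqi; rewrite le_eqVlt => /orP[/eqP E|lt]; [left|right].
    split=> // j; rewrite leq_eqVlt => /orP[/eqP/val_inj <-//|]; exact: eqi.
  by split=> //; move: lt; lia.
move=> /combU [al [a [be [b [Aa Bb E1 Ex]]]]].
have a_i : a 0 i = al * (theta 0 i)%:~R.
  by apply: comb_coord_eq Aa => s [_ _]; apply.
have b_i : b 0 i <= be * (theta 0 i - 1)%:~R.
  by apply: (proj1 (comb_face_le _ Bb)) => s [].
have x_ i' : x 0 i' = a 0 i' + b 0 i' by rewrite Ex mxE.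
have al0 := comb_ge0 Aa.
have lam0 : 0 <= lam by rewrite le_max lexx.
(* [b] stays at least one unit below [theta] in coordinate [i], so [x 0 i <= theta 0 i - 1 + al]. *)
have lam_al : lam <= al.
  rewrite ge_max al0 x_ a_i /=; move: b_i; rewrite intrB.
  have -> : be = 1 - al by rewrite E1; ring.
  lra.
(* [r = 0] when [al = 0], and then [lam = 0] as well. *)
pose r := lam / al.
have r_al : r * al = lam.
  rewrite /r; have [E|al_neq0] := eqVneq al 0; last by rewrite divfK.
  by rewrite E mulr0; apply/eqP; rewrite eq_le lam0/= -E.
have r0 : 0 <= r by apply: divr_ge0.
have r1 : r <= 1.
  have [E|al_neq0] := eqVneq al 0; first by rewrite /r E invr0 mulr0.
  by rewrite ler_pdivrMr ?mul1r// lt_neqAle eq_sym al_neq0.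
have := combZ r0 Aa; rewrite r_al => Ara.
apply: (@comb_between _ _ _ 0 (fun k : 'I_n => (k < i)%N) _ _ _ _ Ara).
- move=> k s ki [su le eqi]; split.
  + by move=> j; rewrite !mxE; case: ifP => // _; split=> //;
      have [s0 su1] := su j; apply: le_trans su1.
  + apply: lexle_trans le; apply: lexle_set_coord.
    by rewrite mxE; have [] := su k.
  + move=> j ij; rewrite mxE (_ : j == k = false) ?eqi//.
    by apply: gtn_eqF; apply: leq_trans ij.
- move=> k /negbTE ki; rewrite !mxE ki.
  have := comb_coord_eq (i := k) (c := theta 0 k) _ Ara.
  by rewrite mxE => -> // s [_ _]; apply; rewrite leqNgt ki.
- move=> k ki; right; rewrite !mxE ki mulr0 le_max lexx /=.
  have /andP[a0 au] : 0 <= a 0 k <= al * (u 0 k)%:~R.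
    by apply: comb_box_bounds Aa => s [].
  have /andP[b0 bu] : 0 <= b 0 k <= be * (u 0 k)%:~R.
    by apply: comb_box_bounds Bb => s [].
  rewrite ge_max mulr_ge0//= x_.
  (* The part of [x] outside [r *: a] is [(1 - r) *: a + b], of weight [1 - lam], hence at most
     [(1 - lam) * u] in coordinate [k]. *)
  have : (1 - r) * a 0 k <= (1 - r) * (al * (u 0 k)%:~R).
    by rewrite ler_wpM2l// subr_ge0.
  move: bu; have -> : be = 1 - al by rewrite E1; ring.
  rewrite mulrA (mulrBl al) r_al mul1r; lra.
Qed.

Lemma comb_slice_ge gamma (i : 'I_n) x
    (mu := Num.max 0 ((gamma 0 i)%:~R - x 0 i + 1)) :
  comb (slice_ge gamma i.+1) 1 x ->
  comb (slice_ge gamma i) mu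
    (\row_(k < n) if (k < i)%N then Num.min (x 0 k) (mu * (u 0 k)%:~R)
                  else mu * (gamma 0 k)%:~R).
Proof.
move=> /(comb_reflect u) Ex; set x' := _ - x in Ex.
have {}Ex : comb (slice_le (u - gamma) i.+1) 1 x'.
  by apply: sub_comb Ex => s /slice_reflect; rewrite subKr.
(* Under [x -> u - x] the weight [lam] of the lower slice becomes [mu]; likewise the truncation by
   [max] becomes one by [min]. *)
have muE : mu = Num.max 0 (x' 0 i - ((u - gamma) 0 i)%:~R + 1).
  by rewrite /mu !mxE intrB mul1r; congr Num.max; ring.
have := comb_slice_le Ex; rewrite -muE => /(comb_reflect u) Aq.
set q := \row_k _; set q' := mu *: _ - _ in Aq.
have <- : q' = q.
  apply/rowP => k; rewrite !mxE; case: ifP => _; last by rewrite intrB; ring.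
  rewrite mul1r minEle maxEle.
  by case: ifP; case: ifP; lra.
by apply: sub_comb Aq => s /slice_reflect.
Qed.
End Slices.

(** * Hulls of lexicographic intervals *)

Section LexInterval.
Variables (R : realType) (n : nat) (u : 'rV[int]_n).
Implicit Types (x : 'rV[R]_n) (gamma theta : 'rV[int]_n).

Lemma slice_glue gamma theta (i : 'I_n) x :
  box u gamma -> box u theta -> gamma 0 i < theta 0 i ->
  (forall j : 'I_n, (i < j)%N -> gamma 0 j = theta 0 j) ->
  comb (slice_le u theta i.+1) 1 x -> comb (slice_ge u gamma i.+1) 1 x ->
  comb [set s | box u s /\ (lexle gamma s /\ lexle s theta)] 1 x.
Proof.
move=> gammau thetau ltgt eqgt Dx Ex.
have := comb_slice_le Dx; have := comb_slice_ge Ex.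
set mu := Num.max 0 _; set lam := Num.max 0 _.
set q := \row_k _; set p := \row_k _.
move=> Aq Ap.
have x_i_le : x 0 i <= (theta 0 i)%:~R.
  rewrite -[leRHS]mul1r; apply: (proj1 (comb_face_le _ Dx)) => s [_ le eqi].
  exact: lexle_coord le eqi.
have x_i_ge : (gamma 0 i)%:~R <= x 0 i.
  rewrite -[leLHS]mul1r; apply: (proj1 (comb_face_ge _ Ex)) => s [_ le eqi].
  by apply: lexle_coord le _ => j /eqi ->.
have x_j (j : 'I_n) : (i < j)%N -> x 0 j = (theta 0 j)%:~R.
  move=> ij; rewrite -[RHS]mul1r; apply: comb_coord_eq Dx => s [_ _]; exact.
have x_k k : 0 <= x 0 k <= (u 0 k)%:~R.
  by rewrite -[(u 0 k)%:~R]mul1r; apply: comb_box_bounds Dx => s [].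
(* By integrality, either the gap is 1 and [lam + mu = 1], so that no middle layer remains, or it is
   at least 2 and at most one of [lam] and [mu] is positive. *)
have gap : (theta 0 i)%:~R = (gamma 0 i)%:~R + 1 :> R \/
    (gamma 0 i)%:~R + 2 <= (theta 0 i)%:~R :> R.
  have [E|/eqP ne] := eqVneq (theta 0 i) (gamma 0 i + 1).
    by left; rewrite E intrD.
  by right; rewrite -(intrD R _ 2) ler_int; move: ltgt ne; lia.
have lam0 : 0 <= lam by rewrite le_max lexx.
have mu0 : 0 <= mu by rewrite le_max lexx.
have nu0 : 0 <= 1 - lam - mu.
  by rewrite /lam /mu !maxEle; case: ifP; case: ifP; case: gap; lra.
pose r := x - p - q.
pose l : 'rV[int]_n := \row_k
  if (k < i)%N then 0 else if k == i then gamma 0 i + 1 else theta 0 k.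
pose h : 'rV[int]_n := \row_k
  if (k < i)%N then u 0 k else if k == i then theta 0 i - 1 else theta 0 k.
have Mr : comb [set s | forall k, l 0 k <= s 0 k /\ s 0 k <= h 0 k]
               (1 - lam - mu) r.
  apply: comb_box => // k; rewrite !mxE; have [ki|ki|/val_inj ->] := ltngtP k i.
  - have /andP[xk0 xku] := x_k k.
    have u0 := le_trans xk0 xku.
    have lu : 0 <= lam * (u 0 k)%:~R by apply: mulr_ge0.
    have mun : 0 <= mu * (u 0 k)%:~R by apply: mulr_ge0.
    have nun : 0 <= (1 - lam - mu) * (u 0 k)%:~R by apply: mulr_ge0.
    (* Here [x - p] is [min (x, (1 - lam) u)] and [q] is [min (x, mu u)] with [mu <= 1 - lam], so
       the difference lies between 0 and [(1 - lam - mu) u]. *)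
    rewrite mulr0 maxEle minEle.
    by case: ifP; case: ifP; move: nun; rewrite !mulrBl !mul1r; split; lra.
  - rewrite (_ : k == i = false); last by apply: gtn_eqF.
    rewrite x_j// -(eqgt _ ki).
    by split; rewrite le_eqVlt; apply/orP; left; apply/eqP; ring.
  (* For gap 1 both the weight and [r 0 i] vanish. Otherwise a positive [lam] makes the upper bound
     tight, and a positive [mu] the lower one. *)
  - rewrite eqxx intrD intrB; move: x_i_le x_i_ge; rewrite /lam /mu.
    set t := x 0 i; set a := _%:~R; set b := _%:~R in gap *.
    move=> tb ta; rewrite !maxEle.
    by case: ifP; case: ifP => H1 H2; case: gap => H; split; nra.
have -> : 1 = lam + mu + (1 - lam - mu) :> R by ring.
have -> : x = p + q + r by rewrite /r -(addrA x) -opprD [RHS]addrC subrK.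
apply: combD; first apply: combD.
(* Points of [p] have coordinate [i] equal to [theta 0 i], strictly above [gamma 0 i], and agree
   with [gamma] beyond, so they exceed [gamma]. *)
- apply: sub_comb Ap => s [su le eqi]; split=> //; split=> //.
  right; exists i; rewrite eqi ?leqnn//; split=> //.
    by move=> E; rewrite E ltxx in ltgt.
  by move=> j ij; rewrite eqgt// eqi// ltnW.
- apply: sub_comb Aq => s [su le eqi]; split=> //; split=> //.
  right; exists i; rewrite eqi ?leqnn//; split=> //.
    by move=> E; rewrite E ltxx in ltgt.
  by move=> j ij; rewrite -eqgt// eqi// ltnW.
- apply: sub_comb Mr => s slh.
  have s_i : gamma 0 i < s 0 i < theta 0 i.
    by have := slh i; rewrite !mxE ltnn eqxx; lia.
  have s_j (j : 'I_n) : (i < j)%N -> s 0 j = theta 0 j.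
    move=> ij; have := slh j; rewrite !mxE ltnNge ltnW//= (_ : j == i = false).
      by move=> [le ge]; apply/eqP; rewrite eq_le ge.
    exact: gtn_eqF.
  have /andP[lts_i lti_s] := s_i.
  split; last split.
  + move=> k; have [ki|ki|/val_inj ->] := ltngtP k i.
    * by have := slh k; rewrite !mxE ki.
    * by rewrite s_j.
    * by have := gammau i; have := thetau i; lia.
  + right; exists i; split=> //; first by move=> E; rewrite E ltxx in lts_i.
    by move=> j ij; rewrite s_j ?eqgt.
  + right; exists i; split=> //; by move=> E; rewrite E ltxx in lti_s.
Qed.

(** Coordinates are frozen from the last one down. Once those beyond [k] are frozen, [x 0 k] is at
    most [theta 0 k] and at least [gamma 0 k]; if these coincide, [x] lies on a face of both
    hulls. *)
Lemma comb_slice_descent gamma theta x (m : nat) :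
  comb [set s | box u s /\ lexle s theta] 1 x ->
  comb [set s | box u s /\ lexle gamma s] 1 x ->
  (forall j : 'I_n, (m <= j)%N -> gamma 0 j = theta 0 j) ->
  comb (slice_le u theta m) 1 x /\ comb (slice_ge u gamma m) 1 x.
Proof.
move=> Px Qx; have [nm _|mn] := leqP n m.
  have nj (j : 'I_n) : (m <= j)%N -> False.
    by move=> mj; have := leq_trans (ltn_ord j) (leq_trans nm mj); rewrite ltnn.
  by split; [apply: sub_comb Px|apply: sub_comb Qx] => s [su le];
    split=> // j /nj.
(* The induction runs on the number of frozen coordinates. *)
have -> : m = (n - (n - m))%N by rewrite subKn// ltnW.
elim: (n - m)%N => [|d IH] eqm.
  have nj (j : 'I_n) : (n - 0 <= j)%N -> False.
    by rewrite subn0 leqNgt ltn_ord.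
  by split; [apply: sub_comb Px|apply: sub_comb Qx] => s [su le];
    split=> // j /nj.
have [nd|dn] := leqP n d.
  have E : (n - d.+1 = n - d)%N by lia.
  by rewrite E; apply: IH; rewrite -E.
have kn : (n - d.+1 < n)%N by lia.
pose k := Ordinal kn.
have Ek : (n - d)%N = k.+1 by rewrite /=; lia.
have /IH : forall j : 'I_n, (n - d <= j)%N -> gamma 0 j = theta 0 j.
  by move=> j; rewrite Ek => /ltnW; apply: eqm.
rewrite Ek => -[Dx Ex].
have [s [_ le eqk]|x_le Dk] := comb_face_le (i := k) (c := theta 0 k) _ Dx.
  exact: lexle_coord.
have [s [_ le eqk]|x_ge Ek'] := comb_face_ge (i := k) (c := gamma 0 k) _ Ex.
  by apply: lexle_coord => // j /eqk ->.
have gt_k : gamma 0 k = theta 0 k by apply: eqm.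
have x_kE : x 0 k = 1 * (theta 0 k)%:~R.
  by apply/eqP; rewrite eq_le x_le -gt_k.
split.
  apply: sub_comb (Dk x_kE) => s [[su le eqk] sk]; split=> // j.
  by rewrite leq_eqVlt => /orP[/eqP/(@val_inj _ _ _ k) <-//|]; apply: eqk.
rewrite -gt_k in x_kE.
apply: sub_comb (Ek' x_kE) => s [[su le eqk] sk]; split=> // j.
by rewrite leq_eqVlt => /orP[/eqP/(@val_inj _ _ _ k) <-//|]; apply: eqk.
Qed.

Lemma comb_lex_interval gamma theta x :
  box u gamma -> box u theta ->
  comb [set s | box u s /\ lexle s theta] 1 x ->
  comb [set s | box u s /\ lexle gamma s] 1 x ->
  comb [set s | box u s /\ (lexle gamma s /\ lexle s theta)] 1 x.
Proof.
move=> gammau thetau Px Qx.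
have [eqgt|] := pselect (forall j, gamma 0 j = theta 0 j).
  have [] := comb_slice_descent (m := 0) Px Qx; first by move=> j _.
  move=> Dx _; apply: sub_comb Dx => s [su le eqs]; split=> //; split=> //.
  by left; apply/rowP => j; rewrite eqgt eqs.
move=> neq.
have [[E|[i [_ eqgt lt]]]|[E|[i [_ eqgt lt]]]] := lexle_total gamma theta.
- by case: neq; rewrite E.
- have [Dx Ex] := comb_slice_descent Px Qx eqgt.
  exact: slice_glue Dx Ex.
- by case: neq; rewrite E.
(* Here [theta] precedes [gamma], and the hulls would force [gamma 0 i <= x 0 i <= theta 0 i]. *)
- have [|Dx Ex] := comb_slice_descent (m := i.+1) Px Qx.
    by move=> j /eqgt ->.
  have [s [_ le eqk]|x_le _] := comb_face_le (i := i) (c := theta 0 i) _ Dx.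
    exact: lexle_coord.
  have [s [_ le eqk]|x_ge _] := comb_face_ge (i := i) (c := gamma 0 i) _ Ex.
    by apply: lexle_coord => // j /eqk ->.
  have := le_trans x_ge x_le; rewrite !mul1r ler_int => /(lt_le_trans lt).
  by rewrite ltxx.
Qed.

Lemma convZ_lex_interval gamma theta :
  box u gamma -> box u theta ->
  convZ R [set x | box u x /\ (lexle gamma x /\ lexle x theta)] =
  convZ R [set x | box u x /\ lexle gamma x] `&`
  convZ R [set x | box u x /\ lexle x theta].
Proof.
move=> gammau thetau; apply/seteqP; split=> x.
  move=> /convZE Sx.
  by split; apply/convZE; apply: sub_comb Sx => s [su []].
by move=> [/convZE Qx /convZE Px]; apply/convZE; apply: comb_lex_interval.
Qed.

End LexInterval.

(** * Superincreasing knapsacks as lexicographic sets *)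

Section Knapsack.
Variables (n : nat) (u : 'rV[int]_n).
Implicit Types (a x y : 'rV[int]_n).

(** At the deciding index [i] the increase gains at least [a 0 i], which by superincrease covers any
    loss over the smaller indices. *)
Lemma dotZ_lexle a x y :
  (forall i, 0 < a 0 i) -> superincreasing u a -> box u x -> box u y ->
  lexle x y -> dotZ a x <= dotZ a y.
Proof.
move=> a0 asup xu yu [->//|[i [_ xyj lt]]].
have low : \sum_(k < n | (k < i)%N) a 0 k * u 0 k <= a 0 i.
  (* Superincrease compares consecutive indices, so it is used at [i.-1]; for [i = 0] the sum is
     empty. *)
  case: (posnP i) => [i0|i_gt0].
    by rewrite big1 ?ltW// => k; rewrite i0.
  have pi_lt : (i.-1 < n)%N.
    by apply: leq_ltn_trans (ltn_ord i); apply: leq_pred.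
  have := asup (Ordinal pi_lt) i; rewrite /= prednK// => /(_ erefl).
  by under eq_bigl do rewrite -ltnS prednK//.
rewrite /dotZ (bigID (fun k : 'I_n => (k < i)%N)) /=.
rewrite [leRHS](bigID (fun k : 'I_n => (k < i)%N)) /=.
rewrite (bigD1 (P := fun k : 'I_n => ~~ (k < i)%N) i) ?ltnn//=.
rewrite [X in _ <= _ + X](bigD1 i) ?ltnn//=.
have -> : \sum_(k < n | ~~ (k < i)%N && (k != i)) a 0 k * x 0 k =
    \sum_(k < n | ~~ (k < i)%N && (k != i)) a 0 k * y 0 k.
  apply: eq_bigr => k /andP[]; rewrite -leqNgt leq_eqVlt.
  by move=> /orP[/eqP/val_inj ->|/xyj ->//]; rewrite eqxx.
have lowx : \sum_(k < n | (k < i)%N) a 0 k * x 0 k <= a 0 i.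
  apply: le_trans low; apply: ler_sum => k _.
  by have [_ xku] := xu k; apply: ler_wpM2l => //; apply: ltW.
have lowy : 0 <= \sum_(k < n | (k < i)%N) a 0 k * y 0 k.
  apply: sumr_ge0 => k _; have [yk0 _] := yu k.
  by apply: mulr_ge0 => //; apply: ltW.
have ai : a 0 i * x 0 i + a 0 i <= a 0 i * y 0 i.
  rewrite -[X in _ + X]mulr1 -mulrDr.
  by apply: ler_wpM2l; [exact: ltW|rewrite lezD1].
rewrite !addrA lerD2r; apply: (le_trans (lerD lowx (lexx _))).
by rewrite [leLHS]addrC (le_trans ai)// lerDr.
Qed.

(** Finiteness of the box is what provides lexicographic extrema. The sum of the [absz (u 0 i)]
    serves as a common bound for all coordinates. *)
Lemma box_enum : exists s : seq 'rV[int]_n, forall x, box u x -> x \in s.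
Proof.
pose m := (\sum_(i < n) absz (u 0%R i))%N.
exists [seq \row_i (f i : nat)%:Z | f : {ffun 'I_n -> 'I_m.+1}] => x xu.
apply/mapP; exists [ffun i => inord (absz (x 0 i))]; first exact: mem_enum.
apply/rowP => i; rewrite mxE ffunE inordK.
  by have [x0 _] := xu i; rewrite gez0_abs.
rewrite ltnS /m (bigD1 i)//=; apply: leq_trans (leq_addr _ _).
by have [x0 xu'] := xu i; lia.
Qed.

Lemma lexle_max (K : set 'rV[int]_n) x0 :
  K `<=` box u -> K x0 -> exists2 t, K t & forall x, K x -> lexle x t.
Proof.
move=> Ku Kx0; have [s su] := box_enum.
suff [t Kt tmax] : exists2 t, K t & forall x, x \in s -> K x -> lexle x t.
  by exists t => // x Kx; apply: tmax => //; apply/su/Ku.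
elim: s {su} => [|y s [t Kt tmax]]; first by exists x0.
have [Ky|NKy] := pselect (K y); last first.
  by exists t => // x; rewrite inE => /orP[/eqP ->|/tmax].
have [yt|ty] := lexle_total y t.
  by exists t => // x; rewrite inE => /orP[/eqP ->|/tmax].
exists y => // x; rewrite inE => /orP[/eqP -> _|/tmax xt Kx]; first by left.
by apply: lexle_trans ty; apply: xt.
Qed.

Lemma lexle_min (K : set 'rV[int]_n) x0 :
  K `<=` box u -> K x0 -> exists2 t, K t & forall x, K x -> lexle t x.
Proof.
move=> Ku Kx0.
have [||t Kt tmax] := @lexle_max [set x | K (u - x)] (u - x0).
- by move=> x /Ku /box_reflect; rewrite subKr.
- by rewrite /= subKr.
exists (u - t) => // x Kx.
rewrite -[x](subKr u); apply: lexle_reflect; apply: tmax.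
by rewrite /= subKr.
Qed.

(** Take [theta] to be the largest element of the knapsack: by monotonicity of [dotZ a], every box
    point below it satisfies the constraint. *)
Lemma knapsack_le_lex a b :
  (forall i, 0 < a 0 i) -> superincreasing u a -> knapsack_le u a b !=set0 ->
  exists2 theta, box u theta &
    knapsack_le u a b = [set x | box u x /\ lexle x theta].
Proof.
move=> a0 asup [x0 Kx0].
have [x [] //|t [tu tb] tmax] := lexle_max _ Kx0.
exists t => //; apply/seteqP; split=> x.
  by move=> Kx; split; [case: Kx|apply: tmax].
by move=> [xu xt]; split=> //; apply: le_trans tb; apply: dotZ_lexle.
Qed.

Lemma knapsack_ge_lex a d :
  (forall i, 0 < a 0 i) -> superincreasing u a -> knapsack_ge u a d !=set0 ->
  exists2 gamma, box u gamma &
    knapsack_ge u a d = [set x | box u x /\ lexle gamma x].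
Proof.
move=> a0 asup [x0 Kx0].
have [x [] //|t [tu td] tmin] := lexle_min _ Kx0.
exists t => //; apply/seteqP; split=> x.
  by move=> Kx; split; [case: Kx|apply: tmin].
by move=> [xu xt]; split=> //; apply: (le_trans td); apply: dotZ_lexle.
Qed.

End Knapsack.

Theorem theorem3 (R : realType) (n : nat) (u : 'rV[int]_n)
    (hu : forall i, 0 < u 0 i) :
  (forall gamma theta : 'rV[int]_n, box u gamma -> box u theta ->
     convZ R [set x | box u x /\ (lexle gamma x /\ lexle x theta)] =
     convZ R [set x | box u x /\ lexle gamma x] `&`
     convZ R [set x | box u x /\ lexle x theta]) /\
  (forall (a w : 'rV[int]_n) (b d : int),
     (forall i, 0 < a 0 i) -> (forall i, 0 < w 0 i) -> 0 < b -> 0 < d ->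
     superincreasing u a -> superincreasing u w ->
     convZ R (knapsack_le u a b `&` knapsack_ge u w d) =
     convZ R (knapsack_le u a b) `&` convZ R (knapsack_ge u w d)).
Proof.
split=> [gamma theta|a w b d a0 w0 _ _ asup wsup].
  exact: convZ_lex_interval.
apply/seteqP; split=> x.
  by move=> /convZE Kx; split; apply/convZE; apply: sub_comb Kx => s [].
move=> [Kx Lx].
(* A point in each hull shows that both knapsacks are nonempty, so the extrema [theta] and [gamma]
   exist. *)
have /convZE/comb_neq0/(_ (oner_neq0 R)) K0 := Kx.
have /convZE/comb_neq0/(_ (oner_neq0 R)) L0 := Lx.
have [theta thetau KE] : exists2 theta, box u theta &
    knapsack_le u a b = [set x | box u x /\ lexle x theta].
  by exact: knapsack_le_lex.
have [gamma gammau LE] : exists2 gamma, box u gamma &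
    knapsack_ge u w d = [set x | box u x /\ lexle gamma x].
  by exact: knapsack_ge_lex.
rewrite KE in Kx *; rewrite LE in Lx *.
have : (convZ R [set x | box u x /\ lexle gamma x] `&`
  convZ R [set x | box u x /\ lexle x theta]) x by [].
rewrite -convZ_lex_interval// => /convZE Sx.
by apply/convZE; apply: sub_comb Sx => s [su []].
Qed.
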